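(* Let $G$ be a graph, $S\subseteq V(G)$ and $p=|S|$. Let $k$ be a nonnegative integer such that $|N(u)\setminus N[v]|\geq k$ for all $u,v\in S$ and $|V(G)|-p\leq k$. Then $\mathrm{thin}(G)\geq 1+k+p-|V(G)|$.
   Context: Graphs are finite, simple, undirected. $N(v)$ is the open neighborhood of $v$ and $N[v]=N(v)\cup\{v\}$. For a graph $G=(V,E)$, an ordering $v_1,\dots,v_n$ of $V$ and a partition of $V$ are consistent if for every $r<s<t$, whenever $v_r,v_s$ are in the same class and $v_tv_r\in E$, then $v_tv_s\in E$. $\mathrm{thin}(G)$ is the minimum number of classes of a partition of $V$ consistent with some ordering of $V$.
   Formalization: The condition on N(u)\N[v] is required only for distinct u,v in S, and k<|V(G)| is assumed; this follows when |S|≥2, but without it the claim fails, e.g. one vertex, S empty, k=2 would give thin(G)≥2. *)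

(* Defs.v *)
From HB Require Import structures.
From mathcomp Require Import all_boot.

Set Implicit Arguments.
Unset Strict Implicit.
Unset Printing Implicit Defensive.

Record sgraph := SGraph {
  vertex :> finType;
  adj : rel vertex;
  adj_sym : symmetric adj;
  adj_irr : irreflexive adj
}.

Definition open_nbhd (G : sgraph) (v : G) : {set G} := [set w | adj v w].
Definition closed_nbhd (G : sgraph) (v : G) : {set G} := v |: open_nbhd v.

Definition same_class (T : finType) (P : {set {set T}}) (x y : T) : bool :=
  [exists B in P, (x \in B) && (y \in B)].

(* An ordering v_1, ..., v_n of the vertices is an injective (hence bijective)
   map from 'I_#|G| to G. *)
Definition consistent (G : sgraph) (v : {ffun 'I_#|G| -> G})
    (P : {set {set G}}) : bool :=
  [forall r : 'I_#|G|, forall s : 'I_#|G|, forall t : 'I_#|G|,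
     [&& r < s, s < t, same_class P (v r) (v s) & adj (v t) (v r)]
       ==> adj (v t) (v s)].

Definition has_consistent_partition (G : sgraph) : pred nat := fun m =>
  [exists P : {set {set G}}, exists v : {ffun 'I_#|G| -> G},
     [&& partition P [set: G], injectiveb v, consistent v P & #|P| == m]].

Lemma ex_consistent_partition (G : sgraph) :
  exists m, has_consistent_partition G m.
Proof.
pose P : {set {set G}} := [set [set x] | x in [set: G]].
have memP B : B \in P -> exists x, B = [set x].
  by case/imsetP => x _ ->; exists x.
exists #|P|; apply/existsP; exists P.
apply/existsP; exists [ffun i => enum_val i]; apply/and4P; split=> //.
- apply/and3P; split.
  + apply/eqP/setP => x; rewrite inE; apply/bigcupP; exists [set x].
      exact: imset_f.
    by rewrite inE.
  + apply/trivIsetP => A B /memP[x ->] /memP[y ->] nxy.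
    rewrite disjoints1 inE; apply: contraNN nxy => /eqP ->; exact: eqxx.
  + by apply/negP => /memP[x /setP/(_ x)]; rewrite !inE eqxx.
- by apply/injectiveP => i j; rewrite !ffunE; apply: enum_val_inj.
- apply/forallP => r; apply/forallP => s; apply/forallP => t.
  apply/implyP => /and4P[_ _ /existsP[B /andP[/memP[x ->]]]].
  by rewrite !inE => /andP[/eqP -> /eqP ->].
Qed.

Definition thin (G : sgraph) : nat := ex_minn (ex_consistent_partition G).

(* When S has two distinct elements, the neighbourhood hypothesis already
   bounds k by the number of vertices. *)
Lemma private_nbhd_ltn (G : sgraph) (S : {set G}) (k : nat) :
  1 < #|S| ->
  (forall u v : G, u \in S -> v \in S -> u != v ->
     k <= #|open_nbhd u :\: closed_nbhd v|) ->
  k < #|G|.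
Proof.
case/card_gt1P => u [v [uS vS uv]] /(_ u v uS vS uv) hk.
apply: leq_ltn_trans hk _.
rewrite -cardsT; apply: proper_card; rewrite properT.
by apply/eqP => /setP/(_ v); rewrite !inE eqxx.
Qed.

(* Main.v *)
Require Import Defs.
From mathcomp Require Import all_boot.

(** If [u] precedes [v] in the same class, consistency forces every vertex of
    [N(u) \ N[v]] to precede [v]; hence at least [k + 1] vertices precede [v]
    when [u] and [v] lie in [S]. So the elements of [S] among the first [k + 1]
    vertices lie in pairwise distinct classes, and at most [#|G| - p] of those
    [k + 1] vertices are outside [S]. *)

Lemma card_ord_ltn (n m : nat) : m <= n -> #|[set i : 'I_n | i < m]| = m.
Proof.
move=> le_mn; rewrite cardsE -sum1_card.
by rewrite -(big_ord_widen n (fun=> 1) le_mn) sum1_card card_ord.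
Qed.

Lemma same_class_pblock (T : finType) (P : {set {set T}}) (x y : T) :
  x \in cover P -> y \in cover P -> pblock P x = pblock P y ->
  same_class P x y.
Proof.
move=> xP yP eq_xy; apply/existsP; exists (pblock P x).
by rewrite pblock_mem //= mem_pblock xP eq_xy mem_pblock yP.
Qed.

Lemma private_nbhd_before (G : sgraph) (v : {ffun 'I_#|G| -> G})
    (P : {set {set G}}) (r s : 'I_#|G|) :
  injective v -> consistent v P -> r < s -> same_class P (v r) (v s) ->
  #|open_nbhd (v r) :\: closed_nbhd (v s)| < s.
Proof.
move=> v_inj /forallP/(_ r)/forallP/(_ s)/forallP cons_v lt_rs same_rs.
have [g gK vK] : bijective v by apply: inj_card_bij; rewrite ?card_ord.
have sub : open_nbhd (v r) :\: closed_nbhd (v s)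
             \subset v @: ([set i : 'I_#|G| | i < s] :\ r).
  apply/subsetP => w; rewrite !inE negb_or => /andP[/andP[ws nsw] rw].
  rewrite -[w]vK; apply: imset_f; rewrite !inE; apply/andP; split.
    by apply: contraTneq rw => <-; rewrite vK adj_irr.
  rewrite ltnNge leq_eqVlt negb_or; apply/andP; split.
    apply: contraNneq ws => /val_inj eq_sg.
    by rewrite eq_sg vK.
  apply: contraNN nsw => lt_sg; rewrite adj_sym.
  by have := cons_v (g w); rewrite lt_rs lt_sg same_rs vK adj_sym rw.
apply: leq_ltn_trans (subset_leq_card sub) _.
rewrite card_imset //.
have := cardsD1 r [set i : 'I_#|G| | i < s].
by rewrite inE lt_rs card_ord_ltn ?(ltnW (ltn_ord s)) // add1n => {2}->.
Qed.

Theorem theorem3p11 (G : sgraph) (S : {set G}) (p k : nat)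
    (hp : p = #|S|)
    (hk : k < #|G|)
    (hN : forall u v : G, u \in S -> v \in S -> u != v ->
            k <= #|open_nbhd u :\: closed_nbhd v|)
    (hpk : #|G| - p <= k) :
  1 + k + p - #|G| <= thin G.
Proof.
rewrite /thin; case: ex_minnP => m /existsP[P /existsP[v]] + _.
case/and4P => /and3P[/eqP covP _ _] /injectiveP v_inj cons_v /eqP <-.
pose I := [set i : 'I_#|G| | i < k.+1].
pose F := v @: I.
have cardF : #|F| = k.+1 by rewrite card_imset // card_ord_ltn.
have inP x : x \in cover P by rewrite covP inE.
have no_clash r s : v r \in S -> v s \in S -> s < k.+1 -> r < s ->
    pblock P (v r) != pblock P (v s).
  move=> rS sS le_sk lt_rs; apply/eqP => eqP_rs.
  have same_rs := same_class_pblock _ _ _ _ (inP _) (inP _) eqP_rs.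
  have := private_nbhd_before _ _ _ _ _ v_inj cons_v lt_rs same_rs.
  rewrite ltnNge => /negP[]; apply: leq_trans (hN _ _ rS sS _) => //.
  by rewrite (inj_eq v_inj); apply: contraTneq lt_rs => ->; rewrite ltnn.
have pb_inj : {in F :&: S &, injective (pblock P)}.
  move=> x y /setIP[/imsetP[r + ->] rS] /setIP[/imsetP[s + ->] sS].
  rewrite !inE => le_rk le_sk eq_rs; congr (v _); apply: val_inj.
  case: (ltngtP r s) => // [lt_rs | lt_sr].
    by have := no_clash _ _ rS sS le_sk lt_rs; rewrite eq_rs eqxx.
  by have := no_clash _ _ sS rS le_rk lt_sr; rewrite eq_rs eqxx.
have sub : pblock P @: (F :&: S) \subset P.
  by apply/subsetP => _ /imsetP[x _ ->]; apply: pblock_mem.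
apply: leq_trans (subset_leq_card sub); rewrite card_in_imset //.
by rewrite cardsI cardF -hp add1n leq_sub2l ?max_card.
Qed.
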